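(* Let $0\le m\le n$ be integers, $(\mathcal{C},\otimes,\mathbf{1})$ an additive symmetric monoidal category, $l$ a positive divisor of $n$, $i$ an integer coprime to $l$, and $b\in\mathcal{C}$ an object such that $b^{\otimes l}\simeq\mathbf{1}$. Then there is an isomorphism $$\binom{n}{m}_{b^{\otimes i}}\simeq\binom{n}{m}_{b}$$ in $\mathcal{C}$.
   Context: The Gaussian polynomial is $\binom{n}{m}_t:=\dfrac{(1-t^n)(1-t^{n-1})\cdots(1-t^{n-m+1})}{(1-t)(1-t^2)\cdots(1-t^m)}\in\mathbb{N}[t]$. For an object $b\in\mathcal{C}$ and $p(t)=a_0+a_1t+\cdots+a_Nt^N\in\mathbb{N}[t]$, put $p(b):=\mathbf{1}^{\oplus a_0}\oplus b^{\oplus a_1}\oplus(b^{\otimes2})^{\oplus a_2}\oplus\cdots\oplus(b^{\otimes N})^{\oplus a_N}$; $\binom{n}{m}_b$ denotes this evaluation for $p(t)=\binom{n}{m}_t$. Since $b^{\otimes l}\simeq\mathbf{1}$, $b$ is $\otimes$-invertible, so $b^{\otimes i}$ makes sense for every integer $i$. In an additive symmetric monoidal category $\otimes$ is assumed to be additive in each variable. *)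

(* Defs.v *)
From Stdlib Require Import ClassicalEpsilon.
From mathcomp Require Import all_boot all_order all_algebra.

Set Implicit Arguments.
Unset Strict Implicit.
Unset Printing Implicit Defensive.

Import GRing.Theory.
Local Open Scope ring_scope.

(* [compm g f] is g after f.  Finite biproducts are given by a zero object and
   chosen binary biproducts. *)
Record additive_category := AdditiveCategory {
  Ob :> Type;
  Hom : Ob -> Ob -> zmodType;
  idm : forall a, Hom a a;
  compm : forall a b c, Hom b c -> Hom a b -> Hom a c;
  compm_idl : forall a b (f : Hom a b), compm (idm b) f = f;
  compm_idr : forall a b (f : Hom a b), compm f (idm a) = f;
  compmA : forall a b c d (h : Hom c d) (g : Hom b c) (f : Hom a b),
    compm h (compm g f) = compm (compm h g) f;
  compmDl : forall a b c (g g' : Hom b c) (f : Hom a b),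
    compm (g + g') f = compm g f + compm g' f;
  compmDr : forall a b c (g : Hom b c) (f f' : Hom a b),
    compm g (f + f') = compm g f + compm g f';
  zobj : Ob;
  zero_initial : forall a (f : Hom zobj a), f = 0;
  zero_terminal : forall a (f : Hom a zobj), f = 0;
  dsum : Ob -> Ob -> Ob;
  in1 : forall a b, Hom a (dsum a b);
  in2 : forall a b, Hom b (dsum a b);
  pr1 : forall a b, Hom (dsum a b) a;
  pr2 : forall a b, Hom (dsum a b) b;
  pr1_in1 : forall a b, compm (pr1 a b) (in1 a b) = idm a;
  pr2_in2 : forall a b, compm (pr2 a b) (in2 a b) = idm b;
  pr1_in2 : forall a b, compm (pr1 a b) (in2 a b) = 0;
  pr2_in1 : forall a b, compm (pr2 a b) (in1 a b) = 0;
  dsum_id : forall a b,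
    compm (in1 a b) (pr1 a b) + compm (in2 a b) (pr2 a b) = idm (dsum a b)
}.

Arguments Hom {C} a b : rename.
Arguments idm {C} a : rename.
Arguments compm {C a b c} g f : rename.
Arguments zobj C : rename.
Arguments dsum {C} a b : rename.

Notation "g \c f" := (compm g f) (at level 40, left associativity).

Definition is_iso (C : additive_category) (a b : C) (f : Hom a b) : Prop :=
  exists g : Hom b a, g \c f = idm a /\ f \c g = idm b.

Definition isomorphic (C : additive_category) (a b : C) : Prop :=
  exists f : Hom a b, is_iso f.

Record additive_smc := AdditiveSMC {
  base :> additive_category;
  tunit : base;
  tensor : base -> base -> base;
  thom : forall a b a' b' : base,
    Hom a a' -> Hom b b' -> Hom (tensor a b) (tensor a' b');
  thom_id : forall a b, thom (idm a) (idm b) = idm (tensor a b);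
  thom_comp : forall a b a' b' a'' b'' (f' : Hom a' a'') (f : Hom a a')
      (g' : Hom b' b'') (g : Hom b b'),
    thom (f' \c f) (g' \c g) = thom f' g' \c thom f g;
  thomDl : forall a b a' b' (f f' : Hom a a') (g : Hom b b'),
    thom (f + f') g = thom f g + thom f' g;
  thomDr : forall a b a' b' (f : Hom a a') (g g' : Hom b b'),
    thom f (g + g') = thom f g + thom f g';
  assoc : forall a b c, Hom (tensor (tensor a b) c) (tensor a (tensor b c));
  lunit : forall a, Hom (tensor tunit a) a;
  runit : forall a, Hom (tensor a tunit) a;
  braid : forall a b, Hom (tensor a b) (tensor b a);
  assoc_iso : forall a b c, is_iso (assoc a b c);
  lunit_iso : forall a, is_iso (lunit a);
  runit_iso : forall a, is_iso (runit a);
  assoc_nat : forall a b c a' b' c'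
      (f : Hom a a') (g : Hom b b') (h : Hom c c'),
    assoc a' b' c' \c thom (thom f g) h = thom f (thom g h) \c assoc a b c;
  lunit_nat : forall a a' (f : Hom a a'),
    lunit a' \c thom (idm tunit) f = f \c lunit a;
  runit_nat : forall a a' (f : Hom a a'),
    runit a' \c thom f (idm tunit) = f \c runit a;
  braid_nat : forall a b a' b' (f : Hom a a') (g : Hom b b'),
    braid a' b' \c thom f g = thom g f \c braid a b;
  pentagon : forall a b c d,
    assoc a b (tensor c d) \c assoc (tensor a b) c d =
    thom (idm a) (assoc b c d) \c assoc a (tensor b c) d
      \c thom (assoc a b c) (idm d);
  triangle : forall a b,
    thom (idm a) (lunit b) \c assoc a tunit b = thom (runit a) (idm b);
  hexagon : forall a b c,
    assoc b c a \c braid a (tensor b c) \c assoc a b c =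
    thom (idm b) (braid a c) \c assoc b a c \c thom (braid a b) (idm c);
  braidK : forall a b, braid b a \c braid a b = idm (tensor a b)
}.

Arguments tunit C : rename.
Arguments tensor {C} a b : rename.
Arguments thom {C a b a' b'} f g : rename.

Section Powers.
Variable C : additive_smc.
Implicit Types b : C.

Definition tpow b (n : nat) : C := iterop n (@tensor C) b (tunit C).

(* A chosen tensor inverse of b; meaningful only if b is tensor-invertible. *)
Definition tinv b : C :=
  epsilon (inhabits (tunit C)) (fun c => isomorphic (tensor b c) (tunit C)).

Definition tpowz b (i : int) : C :=
  match i with
  | Posz k => tpow b k
  | Negz k => tpow (tinv b) k.+1
  end.

Definition copies b (k : nat) : C := iterop k (@dsum C) b (zobj C).

Definition peval (p : {poly nat}) b : C :=
  \big[@dsum C/zobj C]_(j < size p) copies (tpow b j) (p`_j)%R.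

Lemma isomorphic_trans (a b c : C) :
  isomorphic a b -> isomorphic b c -> isomorphic a c.
Proof.
move=> [f [f' [f'f ff']]] [g [g' [g'g gg']]].
exists (g \c f), (f' \c g'); split.
  by rewrite -compmA (compmA g') g'g compm_idl.
by rewrite -compmA (compmA f) ff' compm_idl.
Qed.

Lemma tinvP b (l : nat) :
  (0 < l)%N -> isomorphic (tpow b l) (tunit C) ->
  isomorphic (tensor b (tinv b)) (tunit C).
Proof.
move=> l_gt0 bl1; apply: (epsilon_spec (inhabits (tunit C))
  (fun c => isomorphic (tensor b c) (tunit C))).
exists (tpow b l.-1); case: l l_gt0 bl1 => [//|[|l]] _ //= bl1.
by apply: isomorphic_trans bl1; exists (runit b); apply: runit_iso.
Qed.

End Powers.

Definition gauss_num (n m : nat) : {poly int} :=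
  \prod_(j < m) (1 - 'X^(n - j)).

Definition gauss_den (m : nat) : {poly int} := \prod_(j < m) (1 - 'X^(j.+1)).

(* The pseudo-division %/ of {poly int} is here the exact quotient, and its
   coefficients are nonnegative, so that absz forgets nothing; both facts are
   [gaussianE]. *)
Definition gaussian (n m : nat) : {poly nat} :=
  map_poly absz (gauss_num n m %/ gauss_den m).

Lemma gauss_den_lead m : lead_coef (gauss_den m) \is a GRing.unit.
Proof.
rewrite /gauss_den lead_coef_prod rpred_prod // => j _.
by rewrite -opprB lead_coefN unitrN lead_coefXnsubC.
Qed.

Lemma gauss_numSS n m :
  gauss_num n.+1 m.+1 = (1 - 'X^(n.+1)) * gauss_num n m.
Proof. by rewrite /gauss_num big_ord_recl. Qed.

Lemma gauss_num_ex n m :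
  exists q : {poly nat}, map_poly Posz q * gauss_den m = gauss_num n m.
Proof.
elim: n m => [|n IHn] [|m].
- by exists 1; rewrite rmorph1 mul1r /gauss_den /gauss_num !big_ord0.
- by exists 0; rewrite rmorph0 mul0r /gauss_num big_ord_recl expr0 subrr mul0r.
- by exists 1; rewrite rmorph1 mul1r /gauss_den /gauss_num !big_ord0.
have [p Dp] := IHn m; have [q Dq] := IHn m.+1.
exists (p + 'X^(m.+1) * q).
rewrite rmorphD rmorphM /= map_polyXn mulrDl -mulrA Dq gauss_numSS.
rewrite {1}/gauss_den big_ord_recr /= -/(gauss_den m) mulrA Dp.
rewrite {2}/gauss_num big_ord_recr /= -/(gauss_num n m) mulrCA -mulrDr mulrC.
have [le_mn|lt_nm] := leqP m n.
  congr (_ * _); rewrite mulrBr mulr1 -exprD addSn subnKC // addrA.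
  by rewrite subrK.
suff ->: gauss_num n m = 0 by rewrite !mulr0.
rewrite /gauss_num (bigD1 (Ordinal lt_nm)) //= subnn expr0 subrr.
by rewrite mul0r.
Qed.

Lemma gaussianE n m :
  map_poly Posz (gaussian n m) * gauss_den m = gauss_num n m.
Proof.
have [q Dq] := gauss_num_ex n m.
suff ->: gaussian n m = q by [].
rewrite /gaussian -Dq Pdiv.IdomainUnit.mulpK ?gauss_den_lead //.
by apply/polyP => j; rewrite !coef_map_id0.
Qed.

(* Main.v *)
(* Put G(Y) = prod_(j < n) (1 + t^j Y); by the q-binomial theorem its
   coefficient of Y^m is t^C(m,2) [n, m]_t.  If t^l = 1 and l divides n, the
   exponents j run through each residue class mod l equally often, so G is
   unchanged when j is replaced by an affine function a j + c with a prime to l.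
   For t^j -> t^(rj) this compares [n, m]_t and [n, m]_(t^r) up to a power of t;
   for t^j -> t^(j+1) it shows that t^m fixes [n, m]_t, which absorbs that
   power.  Hence [n, m]_(t^r) = [n, m]_t in Z[t]/(t^l - 1), that is, the sums of
   the coefficients of both polynomials over each residue class of exponents
   mod l agree.  In the category, both sides split into copies of b^j, j < l,
   with these sums as multiplicities. *)
From Stdlib Require Import Setoid Morphisms.
Require Import Defs.
From mathcomp Require Import all_boot all_order all_algebra.
From mathcomp Require Import zify ring qpoly.

Set Implicit Arguments.
Unset Strict Implicit.
Unset Printing Implicit Defensive.

Import GRing.Theory.

(** * Isomorphism as a rewriting relation *)

Lemma isomorphic_refl (C : additive_category) (a : C) : isomorphic a a.
Proof. by exists (idm a), (idm a); rewrite compm_idl. Qed.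

#[local] Hint Resolve isomorphic_refl : core.

Lemma isomorphic_sym (C : additive_category) (a b : C) :
  isomorphic a b -> isomorphic b a.
Proof. by move=> [f [g [gf fg]]]; exists g, f. Qed.

#[global] Instance isomorphic_equivalence (C : additive_smc) :
  Equivalence (@isomorphic C).
Proof.
split=> [a|a b|a b c]; [exact: isomorphic_refl | exact: isomorphic_sym |].
exact: isomorphic_trans.
Qed.

(** * Biproducts up to isomorphism *)

Section DirectSums.
Variable C : additive_smc.
Implicit Types a b c : C.
Local Open Scope ring_scope.

Lemma dsum_ext a b c (f g : Defs.Hom c (dsum a b)) :
  pr1 a b \c f = pr1 a b \c g -> pr2 a b \c f = pr2 a b \c g -> f = g.
Proof.
move=> e1 e2; rewrite -[f]compm_idl -[g]compm_idl -dsum_id !compmDl.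
by rewrite -!compmA e1 e2.
Qed.

Lemma compm0 a b c (f : Defs.Hom b c) :
  f \c (0 : Defs.Hom a b) = 0 :> Defs.Hom a c.
Proof. by apply: (addrI (f \c 0)); rewrite -compmDr !addr0. Qed.

Lemma comp0m a b c (f : Defs.Hom a b) :
  (0 : Defs.Hom b c) \c f = 0 :> Defs.Hom a c.
Proof. by apply: (addrI (0 \c f)); rewrite -compmDl !addr0. Qed.

Definition pairm a b c (f : Defs.Hom c a) (g : Defs.Hom c b) :
  Defs.Hom c (dsum a b) :=
  in1 a b \c f + in2 a b \c g.

Lemma pr1_pairm a b c (f : Defs.Hom c a) (g : Defs.Hom c b) :
  pr1 a b \c pairm f g = f.
Proof.
by rewrite compmDr !compmA pr1_in1 pr1_in2 compm_idl comp0m addr0.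
Qed.

Lemma pr2_pairm a b c (f : Defs.Hom c a) (g : Defs.Hom c b) :
  pr2 a b \c pairm f g = g.
Proof.
by rewrite compmDr !compmA pr2_in1 pr2_in2 compm_idl comp0m add0r.
Qed.

Lemma pr1_pairmA a b c d (f : Defs.Hom c a) (g : Defs.Hom c b)
    (h : Defs.Hom d c) :
  pr1 a b \c (pairm f g \c h) = f \c h.
Proof. by rewrite compmA pr1_pairm. Qed.

Lemma pr2_pairmA a b c d (f : Defs.Hom c a) (g : Defs.Hom c b)
    (h : Defs.Hom d c) :
  pr2 a b \c (pairm f g \c h) = g \c h.
Proof. by rewrite compmA pr2_pairm. Qed.

Definition pairmE := (pr1_pairm, pr2_pairm, pr1_pairmA, pr2_pairmA).

#[global] Instance dsum_proper :
  Proper (@isomorphic C ==> @isomorphic C ==> @isomorphic C) (@dsum C).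
Proof.
move=> a a' [f [f' [f'f ff']]] b b' [g [g' [g'g gg']]].
exists (pairm (f \c pr1 a b) (g \c pr2 a b)).
exists (pairm (f' \c pr1 a' b') (g' \c pr2 a' b')).
by split; apply: dsum_ext;
  rewrite compm_idr compmA pairmE -compmA pairmE compmA
    ?f'f ?ff' ?g'g ?gg' compm_idl.
Qed.

Lemma dsumC a b : isomorphic (dsum a b) (dsum b a).
Proof.
exists (pairm (pr2 a b) (pr1 a b)), (pairm (pr2 b a) (pr1 b a)).
by split; apply: dsum_ext; rewrite compm_idr !pairmE.
Qed.

Lemma dsumA a b c : isomorphic (dsum a (dsum b c)) (dsum (dsum a b) c).
Proof.
exists (pairm (pairm (pr1 _ _) (pr1 _ _ \c pr2 _ _)) (pr2 _ _ \c pr2 _ _)).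
exists (pairm (pr1 _ _ \c pr1 _ _) (pairm (pr2 _ _ \c pr1 _ _) (pr2 _ _))).
by split; apply: dsum_ext; try apply: dsum_ext;
  rewrite compm_idr pairmE ?pairmE // -compmA !pairmE.
Qed.

Lemma dsum0x a : isomorphic (dsum (zobj C) a) a.
Proof.
exists (pr2 (zobj C) a), (in2 (zobj C) a); split; last exact: pr2_in2.
by rewrite -dsum_id (zero_terminal (pr1 _ _)) compm0 add0r.
Qed.

Lemma dsumx0 a : isomorphic (dsum a (zobj C)) a.
Proof. by rewrite dsumC dsum0x. Qed.

Lemma dsumACA a b c d :
  isomorphic (dsum (dsum a b) (dsum c d)) (dsum (dsum a c) (dsum b d)).
Proof. by rewrite -!dsumA (dsumA b) (dsumC b c) -(dsumA c). Qed.

Section BigDsum.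
Variables (I : eqType) (s : seq I).
Implicit Types F G : I -> C.

Lemma big_dsum_isomorphic F G :
  (forall i, isomorphic (F i) (G i)) ->
  isomorphic (\big[@dsum C/zobj C]_(i <- s) F i)
             (\big[@dsum C/zobj C]_(i <- s) G i).
Proof.
move=> FG; apply: (big_ind2 (@isomorphic C)) => //.
by move=> a a' b b' aa' bb'; rewrite aa' bb'.
Qed.

Lemma big_dsum_split F G :
  isomorphic (\big[@dsum C/zobj C]_(i <- s) dsum (F i) (G i))
    (dsum (\big[@dsum C/zobj C]_(i <- s) F i)
          (\big[@dsum C/zobj C]_(i <- s) G i)).
Proof.
elim: s => [|i s' IHs]; first by rewrite !big_nil dsum0x.
by rewrite !big_cons IHs dsumACA.
Qed.

Lemma big_dsum_zobj :
  isomorphic (\big[@dsum C/zobj C]_(i <- s) zobj C) (zobj C).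
Proof.
elim: s => [|i s' IHs]; first by rewrite big_nil.
by rewrite big_cons IHs dsum0x.
Qed.

(** The vanishing is an equality of objects because [copies a 0] computes to [zobj C]. *)
Lemma big_dsum_single F i :
    uniq s -> i \in s -> (forall j, j != i -> F j = zobj C) ->
  isomorphic (\big[@dsum C/zobj C]_(j <- s) F j) (F i).
Proof.
move=> + + F0; elim: s => //= k s' IHs /andP[ks' us']; rewrite in_cons.
case: eqVneq ks' => [<- is' _ | neq_ik _ /= is'] /=; last first.
  by rewrite big_cons F0 1?eq_sym // dsum0x IHs.
rewrite big_cons.
suff -> : isomorphic (\big[@dsum C/zobj C]_(j <- s') F j) (zobj C).
  exact: dsumx0.
rewrite big_seq; apply: (big_ind (fun a => isomorphic a (zobj C))) => //.
  by move=> a c -> ->; rewrite dsum0x.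
by move=> j js'; rewrite F0 //; apply: contraNneq is' => <-.
Qed.

End BigDsum.

(** Only up to isomorphism: [iterop] makes one copy [a] itself, not [dsum a (zobj C)]. *)
Lemma copiesS a k : isomorphic (copies a k.+1) (dsum a (copies a k)).
Proof. by case: k => [|k] //=; rewrite dsumx0. Qed.

Lemma copiesD a k k' :
  isomorphic (copies a (k + k')) (dsum (copies a k) (copies a k')).
Proof.
elim: k => [|k IHk]; first by rewrite dsum0x.
by rewrite addSn !copiesS IHk dsumA.
Qed.

#[global] Instance copies_proper :
  Proper (@isomorphic C ==> eq ==> @isomorphic C) (@copies C).
Proof.
move=> a b ab k _ <-; elim: k => [|k IHk] //.
by rewrite !copiesS IHk ab.
Qed.

End DirectSums.

(** * Gaussian polynomials as coefficients of a product *)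

Section QBinomial.
Local Open Scope ring_scope.

(** The polynomial G(Y), with ['X] in the role of Y. *)
Definition qprod (A : comNzRingType) (t : A) (n : nat) : {poly A} :=
  \prod_(j < n) (1 + t ^+ j *: 'X).

Lemma coefS_mul1X (A : comNzRingType) (c : A) (p : {poly A}) m :
  (p * (1 + c *: 'X))`_m.+1 = p`_m.+1 + c * p`_m.
Proof. by rewrite mulrDr mulr1 -scalerAr coefD coefZ coefMX. Qed.

Lemma coef_comp_scaleX (A : comNzRingType) (c : A) (p : {poly A}) m :
  (p \Po (c *: 'X))`_m = c ^+ m * p`_m.
Proof.
elim/poly_ind: p m => [|p a IHp] m; first by rewrite comp_poly0 coef0 mulr0.
rewrite comp_poly_MXaddC -scalerAr !coefD coefZ !coefMX !coefC.
by case: m => [|m] /=; rewrite ?IHp ?mulr0 ?expr0 ?mul1r // !addr0 exprS mulrA.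
Qed.

(* The functional equation G(tY) (1 + Y) = G(Y) (1 + t^n Y) of G = qprod t n. *)
Lemma qprod_coefS (A : comNzRingType) (t : A) n m :
  t ^+ m.+1 * (qprod t n)`_m.+1 + t ^+ m * (qprod t n)`_m =
    (qprod t n)`_m.+1 + t ^+ n * (qprod t n)`_m.
Proof.
have := coefS_mul1X (t ^+ n) (qprod t n) m.
have -> : qprod t n * (1 + t ^+ n *: 'X) =
          (qprod t n \Po (t *: 'X)) * (1 + 1 *: 'X).
  (* Both sides are [qprod t n.+1], with its last and its first factor split off. *)
  transitivity (qprod t n.+1); first by rewrite /qprod big_ord_recr.
  rewrite /qprod big_ord_recl expr0 mulrC; congr (_ * _).
  rewrite rmorph_prod /=; apply: eq_bigr => j _.
  by rewrite comp_polyD comp_polyC comp_polyZ comp_polyX scalerA -exprSr.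
by rewrite coefS_mul1X !coef_comp_scaleX mul1r.
Qed.

Lemma qprod_coef0 (A : comNzRingType) (t : A) n : (qprod t n)`_0 = 1.
Proof.
rewrite -horner_coef0 horner_prod big1 // => j _.
by rewrite hornerD hornerZ hornerX mulr0 addr0 hornerC.
Qed.

Lemma gauss_den_neq0 m : gauss_den m != 0.
Proof.
rewrite -lead_coef_eq0; apply: contraTneq (gauss_den_lead m) => ->.
by rewrite unitr0.
Qed.

(** The functional equation gives the ratio (t^m - t^n) / (1 - t^(m+1)) of consecutive coefficients,
    and induction on m multiplies these up. Over the domain Z[t], [gauss_den m] can be cancelled. *)
Lemma qprod_coef_gaussian n m : (m <= n)%N ->
  (qprod ('X : {poly int}) n)`_m =
    'X^('C(m, 2)) * map_poly Posz (gaussian n m).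
Proof.
move=> le_mn; apply: (mulIf (gauss_den_neq0 m)); rewrite -mulrA gaussianE.
elim: m le_mn => [|m IHm] lt_mn.
  by rewrite qprod_coef0 /gauss_den /gauss_num !big_ord0.
have le_mn := ltnW lt_mn; have := qprod_coefS ('X : {poly int}) n m.
rewrite /gauss_den /gauss_num !big_ord_recr /=.
rewrite -/(gauss_den m) -/(gauss_num n m) binS bin1 exprD.
have -> : 'X^n = 'X^m * 'X^(n - m) :> {poly int} by rewrite -exprD subnKC.
move: (IHm le_mn).
move: (qprod _ _)`_m (qprod _ _)`_m.+1 => g g' IH E.
transitivity (g' * (1 - 'X^(m.+1)) * gauss_den m); first by ring.
have -> : g' * (1 - 'X^(m.+1)) = 'X^m * (1 - 'X^(n - m)) * g.
  apply/eqP; rewrite -subr_eq0 -(subrr (g' + 'X^m * 'X^(n - m) * g)) -{2}E.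
  by apply/eqP; ring.
by rewrite -[_ * g * _]mulrA IH; ring.
Qed.

Definition evalZ (A : comNzRingType) (t : A) (p : {poly nat}) : A :=
  \sum_(k < size p) t ^+ k *+ (p`_k)%R.

(** The identity over Z[X] is specialised along X -> t, as A may have zero divisors. *)
Lemma qprod_coef (A : comNzRingType) (t : A) n m : (m <= n)%N ->
  (qprod t n)`_m = t ^+ 'C(m, 2) * evalZ t (gaussian n m).
Proof.
move=> le_mn.
have [ev evE] : exists ev : {rmorphism {poly int} -> A},
    forall p, ev p = (map_poly intr p).[t].
  by exists (horner_eval t \o map_poly intr).
have evX k : ev 'X^k = t ^+ k.
  by rewrite evE rmorphXn /= map_polyX hornerXn.
have -> : qprod t n = map_poly ev (qprod 'X n).
  rewrite /qprod rmorph_prod /=; apply: eq_bigr => j _.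
  by rewrite rmorphD rmorph1 /= map_polyZ /= map_polyX evX.
rewrite coef_map /= qprod_coef_gaussian // rmorphM /= evX evE; congr (_ * _).
rewrite (@horner_coef_wide _ (size (gaussian n m))); last first.
  by do 2!apply: leq_trans (size_poly _ _) _.
apply: eq_bigr => k _; rewrite -mulr_natl; congr (_ * _).
by rewrite !coef_map_id0 ?mulr0z.
Qed.

(** An affine map with slope prime to l permutes the residues mod l. *)
Lemma prod_modn_affine (A : comNzRingType) (F : nat -> A) l a c :
  (0 < l)%N -> coprime a l ->
  \prod_(j < l) F ((a * j + c) %% l)%N = \prod_(j < l) F j.
Proof.
move=> l_gt0 co_al; pose h (j : 'I_l) := Ordinal (ltn_pmod (a * j + c) l_gt0).
have h_inj : injective h.
  move=> j k /(congr1 val) /= /eqP; rewrite eqn_modDr => e.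
  apply: val_inj; apply/eqP; rewrite /= -(modn_small (ltn_ord j)).
  rewrite -[X in _ == X](modn_small (ltn_ord k)).
  (* The congruence is turned into divisibility of a difference, which is truncated unless k <=
     j. *)
  wlog le_kj : j k e / (k <= j)%N.
    move=> W; case/orP: (leq_total k j) => [|le_jk]; first exact: W.
    by rewrite eq_sym; apply: W => //; rewrite eq_sym.
  move: e; rewrite !eqn_mod_dvd ?leq_mul2l ?le_kj ?orbT //.
  by rewrite -mulnBr Gauss_dvdr // coprime_sym.
by rewrite [RHS](reindex_inj h_inj).
Qed.

(** * Gaussian polynomials at t with t^l = 1 *)

Section RootOfUnity.
Variables (A : comNzRingType) (t : A) (l : nat).
Hypotheses (l_gt0 : (0 < l)%N) (tl1 : t ^+ l = 1).

Lemma expr_mod_root k : t ^+ (k %% l) = t ^+ k.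
Proof.
by rewrite [in RHS](divn_eq k l) exprD mulnC exprM tl1 expr1n mul1r.
Qed.

(** Exponents count only mod l, so the q l factors form q blocks, each running once through all
    residues. *)
Lemma qprod_affine n a c : (l %| n)%N -> coprime a l ->
  \prod_(j < n) (1 + t ^+ (a * j + c) *: 'X) = qprod t n :> {poly A}.
Proof.
move=> /dvdnP[q ->] co_al; rewrite /qprod.
have block (f : nat -> nat) : (forall j k, f (l * j + k)%N = f k %[mod l]) ->
    \prod_(j < q * l) (1 + t ^+ f j *: 'X) =
    (\prod_(j < l) (1 + t ^+ (f j %% l)%N *: 'X)) ^+ q :> {poly A}.
  move=> fP; elim: q => [|q IHq]; first by rewrite big_ord0.
  rewrite -(big_mkord xpredT (fun j => 1 + t ^+ f j *: 'X)).
  rewrite mulSn addnC (big_cat_nat _ (n := q * l)) ?leq_addr //=.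
  rewrite big_mkord IHq exprSr; congr (_ * _).
  rewrite -{1}[(q * l)%N]add0n big_addn addnC addnK big_mkord.
  by apply: eq_bigr => j _; rewrite addnC mulnC -expr_mod_root fP.
rewrite (block (fun j => a * j + c)%N); last first.
  by move=> j k; rewrite mulnDr -addnA mulnCA mulnC modnMDl.
rewrite (block id); last by move=> j k; rewrite mulnC modnMDl.
congr (_ ^+ _).
rewrite (prod_modn_affine (fun j => 1 + t ^+ j *: 'X)) //.
by apply: eq_bigr => j _; rewrite modn_small.
Qed.

Lemma gaussian_root_coprime n m r : (m <= n)%N -> (l %| n)%N -> coprime r l ->
  evalZ (t ^+ r) (gaussian n m) = evalZ t (gaussian n m).
Proof.
move=> le_mn l_dv_n co_rl.
set c := 'C(m, 2); set P := evalZ t _.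
(* t^(l-1) is an inverse of t, so powers of t can be cancelled. *)
have tK k : GRing.lreg (t ^+ k).
  have t_unit : t ^+ l.-1 * t = 1 by rewrite -exprSr prednK.
  move=> x y /(congr1 ( *%R (t ^+ l.-1 ^+ k))).
  by rewrite !mulrA -!exprMn_comm ?t_unit ?expr1n ?mul1r //; exact: mulrC.
have E1 : (t ^+ r) ^+ c * evalZ (t ^+ r) (gaussian n m) = t ^+ c * P.
  rewrite -!qprod_coef //; congr ((_ : {poly A})`_m).
  rewrite -[RHS](qprod_affine 0 l_dv_n co_rl); apply: eq_bigr => j _.
  by rewrite addn0 exprM.
(* Replacing Y by tY shifts each exponent j to j + 1 and multiplies the coefficient of Y^m by
   t^m. *)
have tmP : t ^+ m * P = P.
  apply: (tK c); rewrite mulrCA -qprod_coef // -coef_comp_scaleX.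
  congr ((_ : {poly A})`_m).
  rewrite -[RHS](qprod_affine 1 l_dv_n (coprime1n l)).
  rewrite /qprod rmorph_prod /=; apply: eq_bigr => j _.
  rewrite comp_polyD comp_polyC comp_polyZ comp_polyX scalerA -exprSr.
  by rewrite mul1n addn1.
have tMP k : t ^+ (m * k) * P = P.
  elim: k => [|k IHk]; first by rewrite muln0 mul1r.
  by rewrite mulnS exprD -mulrA IHk tmP.
have c2 : (c.*2 = m * m.-1)%N.
  by rewrite /c -mul2n mul_bin_left bin1 subn1 mulnC.
(* Since 2c is a multiple of m, t^(2c) P = P; hence t^c P = P if l is odd. *)
have : (t ^+ r) ^+ c * P = t ^+ c * P.
  have [l_odd | l_even] := boolP (odd l).
    have lE : l = l./2.*2.+1 by rewrite -[LHS]odd_double_half l_odd.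
    have tcP : t ^+ c * P = P.
      (* With l = 2h + 1, the factor h + 1 inverts 2 mod l: 2c(h + 1) = lc + c. *)
      rewrite -{2}(tMP (m.-1 * l./2.+1)%N) mulnA -c2.
      have -> : (c.*2 * l./2.+1 = l * c + c)%N.
        by rewrite [in RHS]lE; nia.
      by rewrite exprD exprM tl1 expr1n mul1r.
    have -> k : (t ^+ k) ^+ c * P = P.
      elim: k => [|k IHk]; first by rewrite expr0 expr1n mul1r.
      by rewrite exprS exprMn -mulrA IHk tcP.
    by rewrite tcP.
  have r_odd : odd r.
    move: co_rl l_even; rewrite -!dvdn2 => co_rl two_l.
    apply: contraLR co_rl => r_even.
    rewrite /coprime; apply/eqP => g1.
    suff : (2 %| gcdn r l)%N by rewrite g1.
    by rewrite dvdn_gcd two_l andbT dvdn2.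
  (* With r = 2s + 1, t^(rc) is t^c times a power of t^(2c), which fixes P. *)
  rewrite -{1}(odd_double_half r) r_odd exprS exprMn -mulrA; congr (_ * _).
  rewrite -exprM -{2}(tMP (m.-1 * r./2)%N) mulnA -c2; congr (_ ^+ _ * _); nia.
by rewrite -E1 -exprM => /tK ->.
Qed.

End RootOfUnity.

(** * Residue sums as coordinates in Z[t]/(t^l - 1) *)

Definition residue_sum l (p : {poly nat}) r j : nat :=
  (\sum_(k < size p | (r * k) %% l == j) (p`_k)%R)%N.

Notation cyclicZ l := {poly %/ ('X^l - 1 : {poly int})}.

(** [mk_monic] falls back on ['X] for constant or non-monic polynomials; 0 < l excludes this. *)
Lemma mk_monic_Xnsub1 l : (0 < l)%N ->
  mk_monic ('X^l - 1) = 'X^l - 1 :> {poly int}.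
Proof.
by move=> l_gt0; rewrite /mk_monic size_XnsubC // ltnS l_gt0 monicXnsubC.
Qed.

Lemma qpolyX_expr1 l : (0 < l)%N -> 'qX ^+ l = 1 :> cyclicZ l.
Proof.
move=> l_gt0; rewrite /qpolyX -rmorphXn /=; apply/eqP.
rewrite -subr_eq0 -(rmorph1 (in_qpoly _)) -rmorphB /=; apply/eqP/val_inj.
rewrite /= mk_monic_Xnsub1 //.
exact: Pdiv.RingMonic.rmodpp (monicXnsubC _ l_gt0).
Qed.

(* [residue_sum l p r] lists the coordinates of p(t^r) in the basis
   1, t, ..., t^(l-1) of Z[t]/(t^l - 1). *)
Lemma coef_evalZ_qpolyX l (p : {poly nat}) r j : (0 < l)%N ->
  (evalZ ('qX ^+ r : cyclicZ l) p : {poly int})`_j = (residue_sum l p r j)%:Z.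
Proof.
move=> l_gt0.
have coefX k :
    (('qX ^+ r ^+ k : cyclicZ l) : {poly int})`_j = ((r * k) %% l == j)%N%:R.
  (* With its exponent reduced mod l, the monomial has degree below l and is its own remainder. *)
  rewrite -exprM -(expr_mod_root (qpolyX_expr1 l_gt0)) /qpolyX -rmorphXn.
  rewrite in_qpoly_small ?coefXn 1?eq_sym // mk_monic_Xnsub1 //.
  by rewrite size_XnsubC // size_polyXn ltnS ltn_pmod.
rewrite /evalZ poly_of_qpoly_sum coef_sum /residue_sum [in RHS]big_mkcond /=.
rewrite -[RHS]natz natr_sum; apply: eq_bigr => k _.
rewrite [polyn _](raddfMn (@polyn _ _)) coefMn coefX.
by case: eqP => _; rewrite ?mul0rn // -natrM mul1n natz.
Qed.

(** The root of unity is the class of t in Z[t]/(t^l - 1): its first l powers are independent, so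
    equal values have equal residue sums. *)
Lemma gaussian_residues n m l r j :
    (m <= n)%N -> (0 < l)%N -> (l %| n)%N -> coprime r l ->
  residue_sum l (gaussian n m) r j = residue_sum l (gaussian n m) 1 j.
Proof.
move=> le_mn l_gt0 l_dv_n co_rl; apply/eqP; rewrite -eqz_nat.
rewrite -!coef_evalZ_qpolyX // expr1.
by rewrite (gaussian_root_coprime l_gt0 (qpolyX_expr1 l_gt0)).
Qed.

End QBinomial.

(** * Tensor powers up to isomorphism *)

Section TensorPowers.
Variable C : additive_smc.
Implicit Types a b c : C.

#[global] Instance tensor_proper :
  Proper (@isomorphic C ==> @isomorphic C ==> @isomorphic C) (@tensor C).
Proof.
move=> a a' [f [f' [f'f ff']]] b b' [g [g' [g'g gg']]].
exists (thom f g), (thom f' g').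
by rewrite -!thom_comp f'f ff' g'g gg' !thom_id.
Qed.

Lemma tensorA a b c :
  isomorphic (tensor (tensor a b) c) (tensor a (tensor b c)).
Proof. by exists (assoc a b c); apply: assoc_iso. Qed.

Lemma tensor1x a : isomorphic (tensor (tunit C) a) a.
Proof. by exists (lunit a); apply: lunit_iso. Qed.

Lemma tensorx1 a : isomorphic (tensor a (tunit C)) a.
Proof. by exists (runit a); apply: runit_iso. Qed.

Lemma tpowS b k : isomorphic (tpow b k.+1) (tensor b (tpow b k)).
Proof. by case: k => [|k] //=; rewrite tensorx1. Qed.

#[global] Instance tpow_proper :
  Proper (@isomorphic C ==> eq ==> @isomorphic C) (@tpow C).
Proof.
move=> a b ab k _ <-; elim: k => [|k IHk] //.
by rewrite !tpowS IHk ab.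
Qed.

Lemma tpowD b k k' :
  isomorphic (tpow b (k + k')) (tensor (tpow b k) (tpow b k')).
Proof.
elim: k => [|k IHk]; first by rewrite tensor1x.
by rewrite addSn !tpowS IHk tensorA.
Qed.

Lemma tpow_tunit k : isomorphic (tpow (tunit C) k) (tunit C).
Proof. by elim: k => [|k IHk] //; rewrite tpowS IHk tensor1x. Qed.

Lemma tpowM b r k : isomorphic (tpow b (r * k)) (tpow (tpow b r) k).
Proof.
elim: k => [|k IHk]; first by rewrite muln0.
by rewrite mulnS tpowD tpowS IHk.
Qed.

(** * Objects of finite tensor order *)

Section FiniteOrder.
Variables (b : C) (l : nat).
Hypotheses (l_gt0 : (0 < l)%N) (bl1 : isomorphic (tpow b l) (tunit C)).

Lemma tpow_mod k : isomorphic (tpow b k) (tpow b (k %% l)).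
Proof.
by rewrite {1}(divn_eq k l) tpowD mulnC tpowM bl1 tpow_tunit tensor1x.
Qed.

(** Uniqueness of inverses: b^l tensored with the chosen [tinv b] regroups as b^(l-1) tensored with
    the unit. *)
Lemma tinv_tpow : isomorphic (tinv b) (tpow b l.-1).
Proof.
rewrite -(tensor1x (tinv b)) -bl1 -(prednK l_gt0) -addn1 tpowD tensorA.
by rewrite (tinvP l_gt0 bl1) tensorx1 addn1.
Qed.

(** Negative exponents are removed through b^(-1) = b^(l-1); as l - 1 is prime to l, coprimality
    survives. *)
Lemma tpowz_tpow (i : int) : coprimez i l%:Z ->
  exists2 r, coprime r l & isomorphic (tpowz b i) (tpow b r).
Proof.
case: i => k co; first by exists k.
exists (l.-1 * k.+1)%N; last by rewrite tpowM /tpowz tinv_tpow.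
rewrite coprimeMl; apply/andP; split; last exact: co.
by rewrite coprime_sym coprimenP.
Qed.

(** (b^r)^k depends only on r k mod l, so the summands can be collected by residue. *)
Lemma peval_tpow_residue (p : {poly nat}) r :
  isomorphic (peval p (tpow b r))
    (\big[@dsum C/zobj C]_(j < l) copies (tpow b j) (residue_sum l p r j)).
Proof.
(* [D] turns sums of multiplicity functions into direct sums, so the terms of p can be added one at
   a time. *)
pose D (f : nat -> nat) := \big[@dsum C/zobj C]_(j < l) copies (tpow b j) (f j).
have eqD f g : f =1 g -> isomorphic (D f) (D g).
  by move=> fg; apply: big_dsum_isomorphic => j; rewrite fg.
have D0 : isomorphic (D (fun=> 0)) (zobj C) by apply: big_dsum_zobj.
have DD f g : isomorphic (D (fun j => f j + g j)) (dsum (D f) (D g)).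
  rewrite -big_dsum_split; apply: big_dsum_isomorphic => j; exact: copiesD.
(* A single term of p has its multiplicity concentrated at one residue. *)
have D1 k (x : nat) :
    isomorphic (D (fun j => if (r * k) %% l == j then x else 0))
      (copies (tpow (tpow b r) k) x).
  rewrite -tpowM tpow_mod.
  pose j0 : 'I_l := Ordinal (ltn_pmod (r * k) l_gt0).
  rewrite /D (big_dsum_single (i := j0)) ?index_enum_uniq ?mem_index_enum //.
    by rewrite eqxx.
  by move=> j; rewrite -val_eqE eq_sym /= => /negPf ->.
rewrite /peval -/(D (residue_sum l p r)) /residue_sum.
elim: (index_enum _) => [|k s IHs].
  by rewrite big_nil -D0; apply: eqD => j; rewrite big_nil.
rewrite big_cons IHs -D1 -DD; apply: eqD => j.
by rewrite big_cons; case: eqP.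
Qed.

End FiniteOrder.
End TensorPowers.

Theorem corollaryA4 (C : additive_smc) (n m l : nat) (i : int) (b : C)
    (le_mn : (m <= n)%N) (l_gt0 : (0 < l)%N) (l_dvd_n : (l %| n)%N)
    (coprime_il : coprimez i l%:Z)
    (bl1 : isomorphic (tpow b l) (tunit C)) :
  isomorphic (peval (gaussian n m) (tpowz b i)) (peval (gaussian n m) b).
Proof.
have [r co_rl bi] := tpowz_tpow l_gt0 bl1 coprime_il.
have -> : isomorphic (peval (gaussian n m) (tpowz b i))
                     (peval (gaussian n m) (tpow b r)).
  by apply: big_dsum_isomorphic => k; rewrite bi.
(* [tpow b 1] computes to [b], so both sides become evaluations at powers of b, with exponents r and
   1. *)
rewrite -[b in X in isomorphic _ X]/(tpow b 1).
rewrite !(peval_tpow_residue l_gt0 bl1).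
by under eq_bigr => j _ do rewrite gaussian_residues //.
Qed.
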